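(* Fix a positive integer $n$. For a prime $p$, identify $\mathbb{F}_p=\{\bar 0,\bar 1,\dots,\overline{p-1}\}$ and define $$h_p:\mathrm{GL}_n(\mathbb{F}_p)\to[0,1]^{n^2},\qquad A=(\overline{a_{ij}})\mapsto\Big(\tfrac{a_{ij}}{p}\Big)_{1\le i,j\le n},$$ where $a_{ij}\in\{0,1,\dots,p-1\}$. Let $R\subset[0,1]^{n^2}$ be a measurable set with the following property: for every $\epsilon>0$ there exist two finite collections of non-overlapping rectangles $R_1,\dots,R_k$ and $R^1,\dots,R^l$ such that $\bigcup_{i=1}^k R_i\subset R\subset\bigcup_{j=1}^l R^j$, $\mathrm{area}(R\setminus\bigcup_{i=1}^k R_i)<\epsilon$ and $\mathrm{area}(\bigcup_{j=1}^l R^j\setminus R)<\epsilon$. Then $$\lim_{p\to\infty}\frac{\#(\mathrm{Image}(h_p)\cap R)}{\#\mathrm{GL}_n(\mathbb{F}_p)}=\mathrm{area}(R),$$ where the limit is over primes $p$.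
   Context: A rectangle in $[0,1]^{d}$ means a box, i.e. a product $I_1\times\cdots\times I_d$ of subintervals of $[0,1]$. ''area'' denotes $d$-dimensional Lebesgue measure. $\mathrm{GL}_n(\mathbb{F}_p)$ is the group of invertible $n\times n$ matrices over $\mathbb{F}_p$. *)

(* Defs.v *)
From HB Require Import structures.
From mathcomp Require Import all_boot all_order all_algebra all_fingroup.
From mathcomp Require Import all_classical all_reals all_analysis.

Set Implicit Arguments.
Unset Strict Implicit.
Unset Printing Implicit Defensive.
Import Order.TTheory GRing.Theory Num.Theory.
Import numFieldNormedType.Exports.

Local Open Scope classical_set_scope.
Local Open Scope ring_scope.

(* The library has product measures of two factors only.  Lebesgue measure on
   R^d = d.-tuple R is built here as follows: the d-fold product of
   lebesgue_measure on the Borel (product) sigma-algebra, by iterating \x along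
   R x R^d -> R^(d+1), and then its Caratheodory completion, so that all
   Lebesgue-measurable sets are covered, as in completed_lebesgue_measure. *)

Section lebesgue_cons.
Local Open Scope ereal_scope.
Context {R : realType} (d : nat).
Local Notation T := (measurableTypeR R).
Variable m : {sigma_finite_measure set (d.-tuple T) -> \bar R}.

Definition tcons (z : T * d.-tuple T) : d.+1.-tuple T :=
  [the d.+1.-tuple T of z.1 :: z.2].

Lemma measurable_tcons : measurable_fun setT tcons.
Proof. exact: measurable_cons. Qed.

Definition lebesgue_cons : set (d.+1.-tuple T) -> \bar R :=
  pushforward (@lebesgue_measure R \x m) tcons.

Let lebesgue_cons0 : lebesgue_cons set0 = 0.
Proof. by rewrite /lebesgue_cons /pushforward preimage_set0 measure0. Qed.

Let lebesgue_cons_ge0 A : 0 <= lebesgue_cons A.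
Proof. by rewrite /lebesgue_cons /pushforward; exact: measure_ge0. Qed.

Let lebesgue_cons_sigma_additive : semi_sigma_additive lebesgue_cons.
Proof.
have mt A : measurable A -> measurable (tcons @^-1` A).
  by move=> mA; rewrite -[X in measurable X]setTI; exact: measurable_tcons.
move=> F mF tF mUF; rewrite /lebesgue_cons /pushforward preimage_bigcup.
apply: measure_semi_sigma_additive.
- by move=> n; exact: mt.
- apply/trivIsetP => /= i j _ _ ij; rewrite -preimage_setI.
  by move/trivIsetP : tF => /(_ _ _ _ _ ij) ->//; rewrite preimage_set0.
- by rewrite -preimage_bigcup; exact: mt.
Qed.

HB.instance Definition _ := isMeasure.Build _ _ _ lebesgue_cons
  lebesgue_cons0 lebesgue_cons_ge0 lebesgue_cons_sigma_additive.

Let tuncons (x : d.+1.-tuple T) : T * d.-tuple T :=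
  (tnth x ord0, behead_tuple x).

Let tconsK : cancel tcons tuncons.
Proof. by move=> -[a b]; congr pair; apply/val_inj. Qed.

Let measurable_tuncons : measurable_fun setT tuncons.
Proof.
apply/measurable_fun_pairP; split; first exact: measurable_tnth.
apply/measurable_fun_tnthP => i.
rewrite (_ : _ \o _ = (@tnth _ T)^~ (lift ord0 i)); first exact: measurable_tnth.
apply/funext => x /=; rewrite (tuple_eta x) tnthS; congr (tnth _ i); exact/val_inj.
Qed.

(* The library's sigma-finite instance on product_measure1 is not found for
   factors that are not subprobabilities. *)
Let lebesgue_prod_sigma_finite : sigma_finite setT (@lebesgue_measure R \x m).
Proof.
have /sigma_finiteP[F [TF ndF Foo]] := sigma_finiteT (@lebesgue_measure R).
have /sigma_finiteP[G [TG ndG Goo]] := sigma_finiteT m.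
exists (fun n => F n `*` G n).
  rewrite -setXTT TF TG; apply/seteqP; split => -[x y] /=.
    move=> [[n _ Fnx] [k _ Gky]]; exists (maxn n k) => //; split.
    - by move: x Fnx; exact/subsetPset/ndF/leq_maxl.
    - by move: y Gky; exact/subsetPset/ndG/leq_maxr.
  by move=> [n _ []/= ? ?]; split; exists n.
move=> k; have [mF Fkoo] := Foo k; have [mG Gkoo] := Goo k.
split; first exact: measurableX.
by rewrite product_measure1E// lte_mul_pinfty// ge0_fin_numE.
Qed.

Let lebesgue_cons_sigma_finite : sigma_finite setT lebesgue_cons.
Proof.
have [F TF Foo] := lebesgue_prod_sigma_finite.
exists (fun k => tuncons @^-1` F k).
  by rewrite -preimage_bigcup -TF preimage_setT.
move=> k; have [mF Fkoo] := Foo k; split.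
  by rewrite -[X in measurable X]setTI; exact: measurable_tuncons.
rewrite /lebesgue_cons /pushforward -comp_preimage.
by rewrite (_ : tuncons \o tcons = id)//; apply/funext => z; exact: tconsK.
Qed.

HB.instance Definition _ := Measure_isSigmaFinite.Build _ _ _ lebesgue_cons
  lebesgue_cons_sigma_finite.

End lebesgue_cons.

Section lebesgue_tuple.
Local Open Scope ereal_scope.
Context (R : realType).
Local Notation T := (measurableTypeR R).

Fixpoint lebesgue_tuple (d : nat) :
    {sigma_finite_measure set (d.-tuple T) -> \bar R} :=
  if d is d'.+1 then lebesgue_cons (lebesgue_tuple d') else \d_ [tuple].

Definition area (d : nat) : set (d.-tuple R) -> \bar R :=
  @completed_measure_extension _ _ _ (lebesgue_tuple d).

Definition area_measurable (d : nat) : set (set (d.-tuple R)) :=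
  (lebesgue_tuple d)^*%mu.-cara.-measurable.

End lebesgue_tuple.

Section rectangles.
Context {R : realType} {d : nat}.

Definition unit_cube : set (d.-tuple R) :=
  [set x | forall i, tnth x i \in `[0, 1]].

(* The intervals may be open, closed, half-open or degenerate. *)
Definition rectangle (I : 'I_d -> interval R) : set (d.-tuple R) :=
  [set x | forall i, tnth x i \in I i].

(* The interior of a product of intervals, in the product topology of R^d. *)
Definition rectangle_interior (I : 'I_d -> interval R) : set (d.-tuple R) :=
  [set x | forall i, [set` I i]^° (tnth x i)].

(* Non-overlapping means with pairwise disjoint interiors. *)
Definition nonoverlapping_rectangles (k : nat)
    (I : 'I_k -> 'I_d -> interval R) :=
  (forall j i, [set` I j i] `<=` [set` `[0, 1]]) /\
  trivIset setT (fun j => rectangle_interior (I j)).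

End rectangles.

Lemma measurable_rectangle (R : realType) (d : nat) (I : 'I_d -> interval R) :
  (@measurable _ (d.-tuple (measurableTypeR R)) (rectangle I)).
Proof.
rewrite (_ : rectangle I =
    \big[setI/setT]_(i < d) ((@tnth d (measurableTypeR R))^~ i @^-1` [set` I i])).
  apply: bigsetI_measurable => i _.
  rewrite -[X in measurable X]setTI; apply: (measurable_tnth i measurableT).
  exact: measurable_itv.
rewrite -bigcap_seq/=.
apply/seteqP; split => x /= H i; [move=> _|]; apply: H; by rewrite /= ?mem_index_enum.
Qed.

Lemma lebesgue_tuple_rectangle (R : realType) (d : nat) (I : 'I_d -> interval R) :
  lebesgue_tuple R d (rectangle I) =
    (\prod_(i < d) (@lebesgue_measure R [set` I i]))%E.
Proof.
elim: d I => [|d IH] I.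
  rewrite big_ord0 /= diracE; have -> // : rectangle I = setT; last by rewrite in_setT.
  by apply/seteqP; split => // x _ [].
rewrite big_ord_recl -IH /= /lebesgue_cons /pushforward.
rewrite (_ : _ @^-1` _ = [set` I ord0] `*` rectangle (fun i => I (lift ord0 i))).
  by rewrite product_measure1E//; exact: measurable_rectangle.
apply/seteqP; split => -[a b] /=.
  move=> H; split; first by have := H ord0.
  by move=> i; have := H (lift ord0 i); rewrite tnthS.
move=> [/= Ha Hb] i; case: (unliftP ord0 i) => [j|] ->; last exact: Ha.
by rewrite tnthS; exact: Hb.
Qed.

Lemma area_lebesgue (R : realType) (d : nat) (A : set (d.-tuple R)) :
  @measurable _ (d.-tuple (measurableTypeR R)) A ->
  area A = lebesgue_tuple R d A /\ area_measurable A.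
Proof.
move=> mA; split.
  by rewrite /area /completed_measure_extension measurable_mu_extE.
exact: caratheodory_measurable_mu_ext.
Qed.

Lemma area_rectangle (R : realType) (d : nat) (I : 'I_d -> interval R) :
  area (rectangle I) = (\prod_(i < d) (@lebesgue_measure R [set` I i]))%E.
Proof.
rewrite -lebesgue_tuple_rectangle.
by have [] := area_lebesgue (measurable_rectangle I).
Qed.

(* An element of 'F_p coerces to its representative in {0, ..., p - 1}, and
   mxvec lists the n^2 entries of a matrix row by row. *)
Definition hmap (R : realType) (n p : nat) (A : {'GL_n.+1(p)}) :
    (n.+1 * n.+1).-tuple R :=
  [tuple (mxvec (GLval A) 0 k : nat)%:R / p%:R | k < n.+1 * n.+1].

Lemma hmapE (R : realType) (n p : nat) (A : {'GL_n.+1(p)}) (i j : 'I_n.+1) :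
  tnth (hmap R A) (mxvec_index i j) = (GLval A i j : nat)%:R / p%:R.
Proof. by rewrite tnth_mktuple mxvecE. Qed.

(* Main.v *)
(* A box inside [0,1]^d contains vol * q^d + o(q^d) points of the grid
   {0, 1/q, ..., (q-1)/q}^d, and all but a proportion 1 - prod_i (1 - p^-i) -> 0
   of the p^(n^2) matrices over F_p are invertible.  Hence the number of points
   of Image(h_p) in S, divided by #GL_n(F_p), is squeezed between quantities
   converging to the total volumes of an inner and of an outer family of boxes.
   Boxes of a non-overlapping family may share grid points on their boundaries;
   for the lower bound they are replaced by their open interiors, which are
   disjoint and have the same volume. *)

Require Import Defs.
From HB Require Import structures.
From mathcomp Require Import all_boot all_order all_algebra all_fingroup finmap.
From mathcomp Require Import all_classical all_reals all_analysis.
From mathcomp Require Import zify ring lra.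

Set Implicit Arguments.
Unset Strict Implicit.
Unset Printing Implicit Defensive.
Import Order.TTheory GRing.Theory Num.Theory.
Import numFieldNormedType.Exports.

Local Open Scope classical_set_scope.
Local Open Scope ring_scope.

(** * Intervals in $[0,1]$ and grid points on a line *)

Lemma le_of_BSide (R : realType) (a b : bool) (x y : R) :
  (BSide a x <= BSide b y)%O -> x <= y.
Proof. by case: a; case: b; rewrite bnd_simp// => /ltW. Qed.

(** Intersecting with $[0,1]$ changes nothing and makes both endpoints finite unless the interval is
    empty; the empty case is represented by [[0, 0[]. *)
Lemma itv_sub_unit (R : realType) (J : interval R) :
  [set` J] `<=` [set` `[0, 1]%R] ->
  exists a b (x y : R), [/\ 0 <= x, y <= 1,
    (BSide a x <= BSide b y)%O &
    [set` J] = [set` Interval (BSide a x) (BSide b y)]].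
Proof.
case: J => l u /setIidl; rewrite -set_itvI => <-.
have : (BLeft 0 <= l `|` BLeft (0 : R))%O by exact: leUr.
have : (u `&` BRight (1 : R) <= BRight 1)%O by exact: leIr.
rewrite (_ : (Interval l u `&` `[0, 1])%O =
  Interval (l `|` BLeft 0)%O (u `&` BRight 1)%O)//.
move: (l `|` _)%O (u `&` _)%O => {}l {}u u1 l0.
have [lu|] := boolP (l < u)%O; last first.
  move=> /set_itv_ge ->; exists true, true, 0, 0.
  by rewrite set_itv_ge ?ltxx.
case: l l0 lu => [a x|c] l0; last by case: c l0; rewrite bnd_simp.
case: u u1 => [b y|c] u1; last by case: c u1; rewrite bnd_simp.
move=> /ltW xy.
exists a, b, x, y; split => //.
by move: l0; rewrite bnd_simp.
Qed.

Lemma sum_ltn_ord (q t : nat) : (\sum_(k < q) (k < t) = minn t q)%N.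
Proof.
elim: q => [|q IH]; first by rewrite big_ord0 minn0.
by rewrite big_ord_recr /= IH; lia.
Qed.

(** With $t = \lfloor yq \rfloor$, every index $k < t$ counts and no index $k > t$ does, while $k =
    t$ may or may not. So the count is $t$ or $t + 1$ at the extremes, within 1 of $yq$. *)
Lemma sum_grid_below (R : realType) (q : nat) (b : bool) (y : R) : (0 < q)%N ->
  0 <= y <= 1 ->
  `|\sum_(k < q) (BRight (k%:R / q%:R : R) <= BSide b y)%O%:R - y * q%:R| <= 1.
Proof.
move=> q0 /andP[y0 y1]; have qR : 0 < q%:R :> R by rewrite ltr0n.
have yq0 : 0 <= y * q%:R by rewrite mulr_ge0// ltW.
have /andP[tl tu] := Num.Theory.truncn_itv yq0; set t := Num.truncn _ in tl tu.
have tq : (t <= q)%N.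
  by rewrite -(ler_nat R) (le_trans tl)// ler_piMl// ltW.
have l : t%:R <= \sum_(k < q) (BRight (k%:R / q%:R : R) <= BSide b y)%O%:R :> R.
  rewrite -{1}(minn_idPl tq) -sum_ltn_ord natr_sum; apply: ler_sum => k _.
  rewrite ler_nat; case: (ltnP k t) => // kt; rewrite lt0b.
  apply: (@le_trans _ _ (BLeft y)); last by rewrite bnd_simp.
  by rewrite bnd_simp ltr_pdivrMr// (lt_le_trans _ tl)// ltr_nat.
have u :
    \sum_(k < q) (BRight (k%:R / q%:R : R) <= BSide b y)%O%:R <= t.+1%:R :> R.
  apply: (@le_trans _ _ (\sum_(k < q) (k < t.+1)%N%:R)); last first.
    by rewrite -natr_sum sum_ltn_ord ler_nat geq_minl.
  apply: ler_sum => k _; rewrite ler_nat.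
  have [kb|//] := boolP (BRight _ <= _)%O.
  rewrite lt0b ltnS Num.Theory.truncn_ge_nat// -ler_pdivrMr//.
  by clear l; move: kb; case: b; rewrite bnd_simp// => /ltW.
rewrite ler_distl; move: l u tl tu; rewrite -natr1; set c := \sum_(_ < _) _.
lra.
Qed.

(** The indicator of the interval is the difference of the indicators of lying below its upper and
    below its lower endpoint; each of the two contributes an error of at most 1. *)
Lemma sum_grid_itv (R : realType) (q : nat) (a b : bool) (x y : R) : (0 < q)%N ->
  0 <= x -> y <= 1 -> (BSide a x <= BSide b y)%O ->
  `|\sum_(k < q) (k%:R / q%:R \in Interval (BSide a x) (BSide b y))%:R
    - (y - x) * q%:R| <= 2.
Proof.
move=> q0 x0 y1 xy; have xy' := le_of_BSide xy.
rewrite (eq_bigr (fun k : 'I_q =>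
    (BRight (k%:R / q%:R : R) <= BSide b y)%O%:R
    - (BRight (k%:R / q%:R : R) <= BSide a x)%O%:R)); last first.
  move=> k _; rewrite itv_boundlr.
  case: (boolP (BRight _ <= BSide a x)%O) => [h|].
    rewrite (le_trans h xy) andbT subrr leNgt.
    by rewrite (lt_le_trans _ h)// bnd_simp.
  rewrite -ltNge subr0 => h; rewrite (_ : (_ <= _)%O = true)//.
  by move: h; case: a {xy} => /=; rewrite !bnd_simp// => /ltW.
rewrite sumrB.
have := sum_grid_below b q0 (y := y); have := sum_grid_below a q0 (y := x).
rewrite !ler_distl (le_trans x0 xy') x0 y1 (le_trans xy' y1).
move=> /(_ isT) + /(_ isT); lra.
Qed.

Lemma lebesgue_measure_bnd (R : realType) (a b : bool) (x y : R) : x <= y ->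
  @lebesgue_measure R [set` Interval (BSide a x) (BSide b y)] = (y - x)%:E.
Proof.
rewrite lebesgue_measure_itv/= lte_fin EFinB le_eqVlt => /orP[/eqP ->|->//].
by rewrite ltxx subee.
Qed.

(** * Grid counts and volumes of boxes *)

Definition grid_point (R : realType) (d q : nat) (f : {ffun 'I_d -> 'I_q}) :
  d.-tuple R := [tuple (f k : nat)%:R / q%:R | k < d].

(** A real sum of indicators, so that a box yields a product of one-dimensional sums and summation
    over a family of sets can be exchanged. *)
Definition grid_count (R : realType) (d q : nat) (A : set (d.-tuple R)) : R :=
  \sum_(f : {ffun 'I_d -> 'I_q}) (grid_point R f \in A)%:R.

(** [fine] loses nothing for sides inside $[0,1]$, whose measure is finite. *)
Definition volume (R : realType) (d : nat) (I : 'I_d -> interval R) : R :=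
  \prod_(i < d) fine (@lebesgue_measure R [set` I i]).

Lemma area_rectangle_volume (R : realType) (d : nat) (I : 'I_d -> interval R) :
  (forall i, [set` I i] `<=` [set` `[0, 1]%R]) ->
  area (rectangle I) = (volume I)%:E.
Proof.
move=> I01; rewrite area_rectangle -prodEFin; apply: eq_bigr => i _.
have [a [b [x [y [_ _ xy ->]]]]] := itv_sub_unit (I01 i).
by rewrite lebesgue_measure_bnd ?(le_of_BSide xy).
Qed.

(** The indicator of a box is the product of the indicators of its sides, and summing such products
    over all [f] is the distributive law. *)
Lemma grid_count_rectangle (R : realType) (d q : nat) (I : 'I_d -> interval R) :
  grid_count q (rectangle I) =
    \prod_(i < d) \sum_(k < q) ((k%:R / q%:R : R) \in I i)%:R.
Proof.
rewrite bigA_distr_bigA; apply: eq_bigr => f _; rewrite -natr_prod; congr _%:R.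
transitivity (\prod_(i < d) (tnth (grid_point R f) i \in I i) : nat)%N.
  have [fI|] := boolP (_ \in rectangle I).
    by rewrite big1// => i _; move: fI; rewrite inE => ->.
  rewrite notin_setE => /existsNP[i /negP/negbTE fi].
  by rewrite (bigD1 i)//= fi mul0n.
by apply: eq_bigr => i _; rewrite tnth_mktuple.
Qed.

Lemma grid_density_itv (R : realType) (J : interval R) :
  [set` J] `<=` [set` `[0, 1]%R] ->
  (\sum_(k < q) ((k%:R / q%:R : R) \in J)%:R) / q%:R @[q --> \oo] -->
    fine (@lebesgue_measure R [set` J]).
Proof.
move=> /itv_sub_unit[a [b [x [y [x0 y1 xy JE]]]]].
rewrite JE lebesgue_measure_bnd ?(le_of_BSide xy)//=.
apply/cvgrPdist_le => /= e e0; near=> q.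
have q0 : (0 < q)%N by near: q; exact: nbhs_infty_gt.
have qR : 0 < q%:R :> R by rewrite ltr0n.
rewrite -(@ler_pM2r _ q%:R)// -[X in _ * X <= _](gtr0_norm qR) -normrM mulrBl.
rewrite -mulrA mulVf ?gt_eqF// mulr1 distrC.
(* [JE] equates sets and not intervals, so membership is transferred point by point. *)
rewrite (eq_bigr (fun k : 'I_q =>
    (k%:R / q%:R \in Interval (BSide a x) (BSide b y))%:R)); last first.
  move=> k _; congr (nat_of_bool _)%:R.
  by have /(congr1 (fun A => A (k%:R / q%:R))) /= := JE;
    rewrite propeqE => -[? ?]; exact/idP/idP.
apply: (le_trans (sum_grid_itv q0 x0 y1 xy)).
(* The counting error is at most 2, hence [q >= 2 / e] suffices. *)
rewrite mulrC -ler_pdivrMr//; near: q; exact: nbhs_infty_ger.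
Unshelve. all: by end_near. Qed.

Lemma grid_density_rectangle (R : realType) (d : nat) (I : 'I_d -> interval R) :
  (forall i, [set` I i] `<=` [set` `[0, 1]%R]) ->
  grid_count q (rectangle I) / q%:R ^+ d @[q --> \oo] --> volume I.
Proof.
move=> I01.
rewrite (_ : (fun q => _) = fun q => \prod_(i < d)
   ((\sum_(k < q) ((k%:R / q%:R : R) \in I i)%:R) / q%:R)); last first.
  apply/funext => q; rewrite grid_count_rectangle big_split/=; congr (_ * _).
  by rewrite big_const_ord iter_mulr_1 exprVn.
apply: cvg_big => [|i _]; first exact: mul_continuous.
exact: grid_density_itv.
Qed.

(** Each side has interior []x, y[], which is again an interval and has the same length, since
    endpoints carry no measure. *)
Lemma rectangle_interior_rectangle (R : realType) (d : nat)
    (I : 'I_d -> interval R) :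
  (forall i, [set` I i] `<=` [set` `[0, 1]%R]) ->
  exists I' : 'I_d -> interval R,
   [/\ forall i, [set` I' i] `<=` [set` `[0, 1]%R],
    rectangle_interior I = rectangle I' & volume I' = volume I].
Proof.
move=> I01.
have : forall i, exists J : interval R, [/\ [set` J] `<=` [set` `[0, 1]%R],
    [set` I i]^° = [set` J] &
    @lebesgue_measure R [set` J] = @lebesgue_measure R [set` I i]].
  move=> i; have [a [b [x [y [x0 y1 xy IE]]]]] := itv_sub_unit (I01 i).
  have IiE : [set` I i]^° = `]x, y[%classic by rewrite IE interior_itv_bnd.
  exists `]x, y[; split => //.
    by rewrite -IiE; apply: subset_trans (I01 i); exact: interior_subset.
  by rewrite IE !lebesgue_measure_bnd// (le_of_BSide xy).
move=> /fin_all_exists[I' I'P]; exists I'; split.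
- by move=> i; have [] := I'P i.
- apply/seteqP; split => t /= tI i; have [_ IE _] := I'P i; move: (tI i).
    by rewrite IE.
  by move=> ?; rewrite IE.
- by apply: eq_bigr => i _; have [_ _ ->] := I'P i.
Qed.

(** * Area of finite unions of boxes *)

Lemma area_le (R : realType) (d : nat) (A B : set (d.-tuple R)) :
  A `<=` B -> (area A <= area B)%E.
Proof. exact: (@le_outer_measure _ _ (lebesgue_tuple R d)^*%mu). Qed.

(** Here $B = A \cup (B \setminus A)$, and area is an outer measure, hence subadditive. *)
Lemma area_leD (R : realType) (d : nat) (A B : set (d.-tuple R)) :
  A `<=` B -> (area B <= area A + area (B `\` A))%E.
Proof.
move=> AB; rewrite -{1}(setDUK AB).
exact: (@outer_measureU2 _ _ (lebesgue_tuple R d)^*%mu).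
Qed.

Lemma area_bigcup_le (R : realType) (d k : nat) (A : 'I_k -> set (d.-tuple R)) :
  (area (\bigcup_i A i) <= \sum_(i < k) area (A i))%E.
Proof.
rewrite (_ : \bigcup_i A i = \big[setU/set0]_(i < k) A i); last first.
  rewrite -bigcup_seq; congr bigcup; apply/seteqP; split => // i _ /=.
  exact: mem_index_enum.
apply: (big_ind2 (fun A x => (area A <= x)%E)) => // [|A1 x1 A2 x2 le1 le2].
  have -> // : area (set0 : set (d.-tuple R)) = 0%E.
  exact: (@outer_measure0 _ _ (lebesgue_tuple R d)^*%mu).
apply: (le_trans (@outer_measureU2 _ _ (lebesgue_tuple R d)^*%mu _ _)).
exact: leeD le1 le2.
Qed.

(** Boxes are Borel, and on Borel sets area agrees with the measure [lebesgue_tuple], which is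
    finitely additive. *)
Lemma area_bigcup_rectangle (R : realType) (d k : nat)
    (I : 'I_k -> 'I_d -> interval R) :
  trivIset setT (fun j => rectangle (I j)) ->
  area (\bigcup_j rectangle (I j)) = (\sum_(j < k) area (rectangle (I j)))%E.
Proof.
move=> tI.
have mI j : measurable (rectangle (I j) : set (d.-tuple (measurableTypeR R))).
  exact: measurable_rectangle.
have mU : measurable
    (\bigcup_j rectangle (I j) : set (d.-tuple (measurableTypeR R))).
  by apply: fin_bigcup_measurable => // *; exact: mI.
have [-> _] := area_lebesgue mU.
rewrite (measure_fin_bigcup (lebesgue_tuple R d) (@finite_finset _ _) tI)//.
rewrite (fsbigE (index_enum 'I_k)) ?index_enum_uniq//; last first.
  by move=> i; rewrite mem_index_enum.
by apply: eq_big => [i|i _]; [rewrite in_setT|have [->] := area_lebesgue (mI i)].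
Qed.

Lemma nonoverlapping_open (R : realType) (d k : nat)
    (I : 'I_k -> 'I_d -> interval R) : nonoverlapping_rectangles I ->
  exists I' : 'I_k -> 'I_d -> interval R,
    [/\ forall j i, [set` I' j i] `<=` [set` `[0, 1]%R],
        trivIset setT (fun j => rectangle (I' j)),
        forall j, rectangle (I' j) `<=` rectangle (I j) &
        forall j, volume (I' j) = volume (I j)].
Proof.
move=> [I01 tI].
have /fin_all_exists[I' I'P] j := rectangle_interior_rectangle (I01 j).
exists I'; split=> [j||j|j]; try by have [] := I'P j.
  rewrite (_ : (fun j => _) = fun j => rectangle_interior (I j))//.
  by apply/funext => j; have [] := I'P j.
have [_ <- _] := I'P j; move=> t tI' i; exact: interior_subset (tI' i).
Qed.

(** Additivity applies to the open interiors, which are disjoint, lie in the union and have the same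
    volumes. *)
Lemma sum_volume_le_area (R : realType) (d k : nat)
    (I : 'I_k -> 'I_d -> interval R) : nonoverlapping_rectangles I ->
  ((\sum_(j < k) volume (I j))%:E <= area (\bigcup_j rectangle (I j)))%E.
Proof.
move=> /nonoverlapping_open[I' [I'01 tI' I'I volI']].
rewrite (eq_bigr _ (fun j _ => esym (volI' j))) -sumEFin.
rewrite (eq_bigr _ (fun j _ => esym (area_rectangle_volume (I'01 j)))).
rewrite -area_bigcup_rectangle//; apply: area_le; exact: subset_bigcup.
Qed.

Lemma area_le_sum_volume (R : realType) (d k : nat)
    (I : 'I_k -> 'I_d -> interval R) :
  (forall j i, [set` I j i] `<=` [set` `[0, 1]%R]) ->
  (area (\bigcup_j rectangle (I j)) <= (\sum_(j < k) volume (I j))%:E)%E.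
Proof.
move=> I01; apply: (le_trans (area_bigcup_le _)); rewrite -sumEFin.
by apply: lee_sum => j _; rewrite area_rectangle_volume.
Qed.

(** * Grid counts of coverings and packings *)

Lemma grid_count_bigcup_le (R : realType) (d q k : nat) (S : set (d.-tuple R))
    (A : 'I_k -> set (d.-tuple R)) : S `<=` \bigcup_j A j ->
  grid_count q S <= \sum_(j < k) grid_count q (A j).
Proof.
move=> SA; rewrite exchange_big/=; apply: ler_sum => f _.
have [|_] := boolP (_ \in S); last exact: sumr_ge0.
rewrite inE => /SA[j _ fA]; rewrite (bigD1 j)//= mem_set// lerDl.
exact: sumr_ge0.
Qed.

(** By disjointness each grid point is counted by at most one [A j]. *)
Lemma grid_count_bigcup_ge (R : realType) (d q k : nat) (S : set (d.-tuple R))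
    (A : 'I_k -> set (d.-tuple R)) :
  trivIset setT A -> \bigcup_j A j `<=` S ->
  \sum_(j < k) grid_count q (A j) <= grid_count q S.
Proof.
move=> tA AS; rewrite exchange_big/=; apply: ler_sum => f _.
have [[j fA]|/forallNP fA] := pselect (exists j, A j (grid_point R f));
  last first.
  by rewrite big1// => j _; rewrite memNset.
rewrite [in leRHS]mem_set; last by apply: AS; exists j.
rewrite (bigD1 j)//= big1 ?addr0 ?lern1 ?leq_b1// => i ij.
rewrite memNset// => fAi; move/eqP : ij; apply.
by apply: tA => //; exists (grid_point R f).
Qed.

(** * The proportion of invertible matrices *)

Lemma bin2_add_sum (m : nat) :
  ('C(m, 2) + \sum_(1 <= i < m.+1) i = m * m)%N.
Proof.
elim: m => [|m IH]; first by rewrite big_geq.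
rewrite big_nat_recr//= binS bin1; move: IH; lia.
Qed.

(** With $m = n + 1$, [card_GL] gives the order $p^{\binom m2} \prod_{i=1}^m (p^i - 1)$. Since
    $\binom m2 + \sum_{i=1}^m i = m^2$, the denominator cancels the first power and leaves one $p^i$
    for each factor. *)
Lemma card_GL_ratio (R : realType) (n p : nat) : prime p ->
  (#|('GL_n.+1(p))%g|%:R : R) / p%:R ^+ (n.+1 * n.+1) =
    \prod_(i < n.+1) (1 - p%:R ^- i.+1).
Proof.
move=> pp; rewrite card_GL// card_Fp//.
have p0 : p%:R != 0 :> R by rewrite pnatr_eq0 -lt0n prime_gt0.
rewrite -bin2_add_sum natrM natrX exprD invfM mulrACA.
rewrite divff ?expf_neq0// mul1r.
rewrite natr_prod expr_sum -prodfV -big_split/= big_add1 big_mkord.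
apply: eq_bigr => i _; rewrite natrB ?expn_gt0 ?prime_gt0// natrX mulrBl mul1r.
by rewrite divff// expf_neq0.
Qed.

(** The product converges along all naturals and equals the ratio at primes. *)
Lemma cvg_card_GL_ratio (R : realType) (n : nat) :
  (#|('GL_n.+1(p))%g|%:R : R) / p%:R ^+ (n.+1 * n.+1)
    @[p --> within [set p : nat | prime p] \oo] --> (1 : R).
Proof.
have : \prod_(i < n.+1) (1 - p%:R ^- i.+1) @[p --> \oo] -->
    \prod_(i < n.+1) (1 : R).
  apply: cvg_big => [|i _]; first exact: mul_continuous.
  rewrite -[X in _ --> X]subr0; apply: cvgB; first exact: cvg_cst.
  apply/cvgrPdist_le => /= e e0; near=> p.
  have p0 : (0 < p)%N by near: p; exact: nbhs_infty_gt.
  have pR : 1 <= p%:R :> R by rewrite ler1n.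
  rewrite sub0r normrN ger0_norm ?invr_ge0 ?exprn_ge0//.
  (* $p^{-(i+1)} \le p^{-1}$, which is at most [e] once [p >= 1 / e]. *)
  apply: (@le_trans _ _ p%:R^-1).
    rewrite lef_pV2 ?posrE ?exprn_gt0 ?ltr0n//.
    exact: ler_eXnr.
  rewrite -[leRHS]invrK lef_pV2 ?posrE ?invr_gt0 ?ltr0n//.
  near: p; exact: nbhs_infty_ger.
rewrite big1_eq => /(@cvg_within_filter _ _ _ _ _ _ [set p | prime p]).
apply: cvg_trans; apply: near_eq_cvg; near=> p.
by rewrite card_GL_ratio//; near: p; exact: near_withinT.
Unshelve. all: by end_near. Qed.

(** * The image of [hmap] inside the grid *)

Definition GL_residues (n p : nat) (A : {'GL_n.+1(p)}) :
    {ffun 'I_(n.+1 * n.+1) -> 'F_p} :=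
  [ffun k => mxvec (GLval A) ord0 k].

Lemma GL_residues_inj (n p : nat) : injective (@GL_residues n p).
Proof.
move=> A B /ffunP AB; apply/val_inj/(can_inj mxvecK)/rowP => k.
by have := AB k; rewrite !ffunE.
Qed.

Lemma grid_point_inj (R : realType) (d q : nat) : injective (@grid_point R d q).
Proof.
move=> f g fg; apply/ffunP => k; apply/val_inj => /=.
(* [f k] is an element of ['I_q], which forces $q > 0$. *)
have q0 : (0 < q)%N by case: (f k) => m; exact: leq_ltn_trans.
have := congr1 (fun t => tnth t k) fg; rewrite !tnth_mktuple.
move=> /(mulIf _)/eqP; rewrite eqr_nat => /(_ _)/eqP; apply.
by rewrite invr_eq0 pnatr_eq0 -lt0n.
Qed.

(** As an ordinal type, ['F_p] has size [p] only through [Fp_cast], for prime [p]; this identifies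
    the two denominators. *)
Lemma hmap_grid_point (R : realType) (n p : nat) (A : {'GL_n.+1(p)}) :
  prime p -> hmap R A = grid_point R (GL_residues A).
Proof.
move=> pp; apply: eq_from_tnth => k; rewrite !tnth_mktuple ffunE.
by congr (_ / _%:R); rewrite -[LHS](Fp_cast pp).
Qed.

(** Since [grid_point] is injective, image points can be counted through their residue functions,
    which form a finite type. *)
Lemma card_image_hmap (R : realType) (n p : nat)
    (S : set ((n.+1 * n.+1).-tuple R)) : prime p ->
  #|` fset_set (range (@hmap R n p) `&` S)|%fset =
    #|[set f in codom (@GL_residues n p) | grid_point R f \in S]%SET|.
Proof.
move=> pp; set F := [set f in _ | _]%SET.
rewrite (_ : range _ `&` S = (@grid_point R _ _) @` [set` F]).
  rewrite fset_set_image// card_imfset/=; last exact: grid_point_inj.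
  rewrite -(card_finset (mem F)); congr #|` _|%fset; apply/fsetP => f.
  by rewrite in_fset_set// mem_setE in_fset.
apply/seteqP; split => [_ [[A _ <-] SA]|_ [f fF <-]].
  exists (GL_residues A); last by rewrite hmap_grid_point.
  by rewrite /= inE codom_f -hmap_grid_point// mem_set.
move: fF; rewrite /= inE => /andP[/codomP[A ->]]; rewrite inE => SA.
by split => //; exists A => //; rewrite hmap_grid_point.
Qed.

(** The image lies in the grid, whence the upper bound. A grid point of [S] outside the image comes
    from a noninvertible matrix, and the lower bound subtracts the number of all of these. *)
Lemma card_image_hmap_bounds (R : realType) (n p : nat)
    (S : set ((n.+1 * n.+1).-tuple R)) : prime p ->
  grid_count p S - (p%:R ^+ (n.+1 * n.+1) - #|('GL_n.+1(p))%g|%:R)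
    <= #|` fset_set (range (@hmap R n p) `&` S)|%fset%:R <= grid_count p S.
Proof.
move=> pp; rewrite card_image_hmap//.
have -> : grid_count p S =
    #|[set f : {ffun 'I_(n.+1 * n.+1) -> 'F_p} | grid_point R f \in S]%SET|%:R.
  (* The grid indexed by ['I_p] is re-indexed by ['F_p]. *)
  rewrite -{1}(Fp_cast pp) /grid_count -natr_sum; congr _%:R.
  rewrite -sum1_card [in RHS]big_mkcond; apply: eq_bigr => f _.
  by rewrite finset.in_set; case: (_ \in S).
set U := codom _; set D := finset _.
have cU : #|U| = #|('GL_n.+1(p))%g|.
  by rewrite card_codom ?cardsT//; exact: GL_residues_inj.
have cT : (#|U| + #|[predC U]| = p ^ (n.+1 * n.+1))%N.
  by rewrite fintype.cardC card_ffun !card_ord Fp_cast.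
rewrite -cU -natrX -cT.
apply/andP; split; last first.
  rewrite ler_nat; apply/fintype.subset_leq_card/fintype.subsetP => f.
  by rewrite !finset.in_set => /andP[].
rewrite natrD addrAC subrr add0r lerBlDr -natrD ler_nat.
(* The grid points of [S] are split by membership in [U]; those outside number at most
   [#|[predC U]|]. *)
rewrite -[X in (X <= _)%N](fintype.cardID (mem U)) leq_add//
  fintype.subset_leq_card//.
  apply/fintype.subsetP => f /andP[/= + fU]; rewrite !finset.in_set => fD.
  exact/andP.
by apply/fintype.subsetP => f /andP[].
Qed.

(** * Squeezing between inner and outer boxes *)

Theorem theorem1p3 (R : realType) (n : nat)
    (S : set ((n.+1 * n.+1).-tuple R))
    (S_cube : S `<=` unit_cube) (S_measurable : area_measurable S)
    (S_approx : forall eps : R, 0 < eps ->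
      exists (k l : nat) (I : 'I_k -> 'I_(n.+1 * n.+1) -> interval R)
          (J : 'I_l -> 'I_(n.+1 * n.+1) -> interval R),
        [/\ nonoverlapping_rectangles I /\ nonoverlapping_rectangles J,
            \bigcup_i rectangle (I i) `<=` S,
            S `<=` \bigcup_j rectangle (J j),
            (area (S `\` \bigcup_i rectangle (I i)) < eps%:E)%E &
            (area (\bigcup_j rectangle (J j) `\` S) < eps%:E)%E]) :
  (#|` fset_set (range (@hmap R n p) `&` S)|%fset%:R / #|('GL_n.+1(p))%g|%:R)%:E
    @[p --> within [set p : nat | prime p] \oo] --> area S.
Proof.
(* Any tolerance yields an outer cover of finite volume; 1 is taken. *)
have S_fin : area S \is a fin_num.
  have [k [l [_ [J [[_ [J01 _]] _ SJ _ _]]]]] := S_approx 1 ltr01.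
  rewrite ge0_fin_numE ?mu_ext_ge0//.
  exact: le_lt_trans (le_trans (area_le SJ) (area_le_sum_volume J01)) (ltry _).
rewrite -(fineK S_fin); apply: cvg_EFin; first by near=> p.
(* Half of [e] pays for replacing [S] by boxes, the other half for the convergence of the grid
   densities. *)
apply/cvgrPdist_le => /= e e0; have e20 : 0 < e / 2 by rewrite divr_gt0.
have [k [l [I [J [[nI nJ] IS SJ areaI areaJ]]]]] := S_approx _ e20.
have [J01 _] := nJ; have [I' [I'01 tI' I'I volI']] := nonoverlapping_open nI.
have lower : fine (area S) - e / 2 <= \sum_(i < k) volume (I i).
  rewrite lerBlDr -lee_fin fineK// EFinD.
  apply: (le_trans (area_leD IS)); apply: leeD (ltW areaI).
  by apply: area_le_sum_volume; case: nI.
have upper : \sum_(j < l) volume (J j) <= fine (area S) + e / 2.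
  rewrite -lee_fin EFinD fineK//.
  apply: (le_trans (sum_volume_le_area nJ)); apply: (le_trans (area_leD SJ)).
  exact: leeD (ltW areaJ).
pose d := (n.+1 * n.+1)%N.
pose G p : R := #|('GL_n.+1(p))%g|%:R.
(* [ratio] turns densities relative to all $p^d$ matrices into quotients by the number of invertible
   ones. *)
pose ratio p := p%:R ^+ d / G p.
have cvg_ratio : ratio p @[p --> within [set p : nat | prime p] \oo] --> (1 : R).
  rewrite -[X in _ --> X]invr1; under eq_fun do rewrite /ratio -invf_div.
  by apply: cvgV; [exact: oner_neq0|exact: cvg_card_GL_ratio].
have cvg_sum m (K : 'I_m -> 'I_d -> interval R) :
    (forall j i, [set` K j i] `<=` [set` `[0, 1]%R]) ->
    (\sum_(j < m) grid_count p (rectangle (K j)) / p%:R ^+ d)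
      @[p --> within [set p : nat | prime p] \oo] --> \sum_(j < m) volume (K j).
  move=> K01; apply: cvg_within_filter.
  apply: cvg_big => [|j _]; first exact: add_continuous.
  exact: grid_density_rectangle.
have cvg_u : (\sum_(j < l) grid_count p (rectangle (J j)) / p%:R ^+ d) * ratio p
    @[p --> within [set p : nat | prime p] \oo] --> \sum_(j < l) volume (J j).
  by rewrite -[X in _ --> X]mulr1; apply: cvgM => //; exact: cvg_sum.
(* With $N$ the total grid count of the open inner boxes, $(N/p^d - 1)\,p^d/G + 1 = (N - (p^d -
   G))/G$: every noninvertible matrix is treated as a point lost from these boxes. *)
have cvg_l :
    (\sum_(i < k) grid_count p (rectangle (I' i)) / p%:R ^+ d - 1) * ratio p + 1
    @[p --> within [set p : nat | prime p] \oo] --> \sum_(i < k) volume (I i).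
  rewrite (_ : \sum_i _ = (\sum_(i < k) volume (I' i) - 1) * 1 + 1); last first.
    by rewrite mulr1 subrK; apply: eq_bigr.
  apply: cvgD; last exact: cvg_cst.
  by apply: cvgM => //; apply: cvgB; [exact: cvg_sum|exact: cvg_cst].
near=> p.
have pp : prime p by near: p; exact: near_withinT.
have G0 : 0 < G p.
  by rewrite ltr0n; apply/card_gt0P; exists 1%g; rewrite finset.in_set.
have p0 : p%:R ^+ d != 0 :> R by rewrite expf_neq0// pnatr_eq0 -lt0n prime_gt0.
have /andP[gl gu] := card_image_hmap_bounds S pp.
rewrite distrC ler_distl; apply/andP; split.
- apply: (@le_trans _ _
    ((\sum_(i < k) grid_count p (rectangle (I' i)) / p%:R ^+ d - 1)
    * ratio p + 1)).
    apply: (@le_trans _ _ (\sum_(i < k) volume (I i) - e / 2)).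
      by have := lower; lra.
    near: p; apply: (cvgr_ge _ cvg_l); lra.
  rewrite -mulr_suml ler_pdivlMr// -/(G p).
  have h : \sum_(i < k) grid_count p (rectangle (I' i)) <= grid_count p S.
    apply: grid_count_bigcup_ge => //; apply: subset_trans IS.
    exact: subset_bigcup.
  apply: le_trans gl.
  rewrite (_ : (_ + 1) * _ = \sum_(i < k) grid_count p (rectangle (I' i))
    - (p%:R ^+ d - G p)) ?lerB//.
  rewrite /ratio; field.
  by rewrite p0 gt_eqF.
- apply: (@le_trans _ _
    ((\sum_(j < l) grid_count p (rectangle (J j)) / p%:R ^+ d)
    * ratio p)).
    rewrite -mulr_suml ler_pdivrMr// -/(G p) /ratio.
    rewrite mulrA divfK ?divfK// ?gt_eqF//.
    apply: (le_trans gu); exact: grid_count_bigcup_le.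
  apply: (@le_trans _ _ (\sum_(j < l) volume (J j) + e / 2)).
    near: p; apply: (cvgr_le _ cvg_u); lra.
  by have := upper; lra.
Unshelve. all: by end_near. Qed.
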